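(* Let $L,M$ be nonnegative integers and $(a,b)$ a pair of coprime integers with $1\leq b<a$. Then \[ \sum_{j\in\mathbb{Z}}(-1)^j q^{\frac{1}{2}j((2ab+1)j+1)}\mathcal{B}(L,M,aj,bj)=F_{a,b}(L,M). \]
   Context: Notation: $(x;q)_n=\prod_{i=0}^{n-1}(1-xq^i)$, $(q)_n=(q;q)_n$; $\begin{bmatrix}n\\ m\end{bmatrix}=\frac{(q)_n}{(q)_m(q)_{n-m}}$ if $m,n-m$ are nonnegative integers, $0$ otherwise. $\mathcal{B}(L,M,a,b)=\begin{bmatrix}L+M+a-b\\ L+a\end{bmatrix}\begin{bmatrix}L+M-a+b\\ L-a\end{bmatrix}$. Continued-fraction data: for coprime $1\le b<a$ let $\mathrm{cf}(a,b)=(a/b-1)^{s}$ with $s=1$ if $a>2b$, $s=-1$ if $a<2b$, $s=0$ if $a=2b$ (so $\mathrm{cf}(2,1)=1$). Write $\mathrm{cf}(a,b)=[a_0,\dots,a_n]=a_0+\cfrac{1}{a_1+\cfrac{1}{\cdots+\frac{1}{a_n}}}$ with positive integers $a_i$, choosing the representation with $a_n\ge 2$ when $(a,b)\ne(2,1)$ (and $\mathrm{cf}(2,1)=[1]$); $n$ is called the order. Put $t_0=0$, $t_j=a_0+\dots+a_{j-1}$ for $1\le j\le n+1$, and $d=d(a,b)=t_{n+1}$. Let $\mathcal I$ be the $d\times d$ matrix with $\mathcal I_{j,k}=\delta_{j,k+1}+\delta_{j,k-1}$ if $j\notin\{t_1,\dots,t_{n+1}\}$ and $\mathcal I_{j,k}=\delta_{j,k+1}+\delta_{j,k}-\delta_{j,k-1}$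 if $j\in\{t_1,\dots,t_{n+1}\}$, and $C=C(a,b)=2I-\mathcal I$. Let $\tau_j=2$ for $1\le j<d$ and $\tau_d=1$. For $m=(m_1,\dots,m_d)\in\mathbb Z_{\ge0}^d$ write $m^TCm=\sum_{j,k}m_jC_{j,k}m_k$ and $n_j=L\delta_{j,1}-\sum_{k=1}^dC_{j,k}m_k$. Define, for $a\le 2b$, $F_{a,b}(L,M)=\sum_{m\in\mathbb Z_{\ge0}^d}q^{m^TCm}\begin{bmatrix}2L+M-m_1\\ 2L\end{bmatrix}\prod_{j=1}^d\begin{bmatrix}\tau_jm_j+n_j\\ \tau_jm_j\end{bmatrix}$, and for $a>2b$, $F_{a,b}(L,M)=\sum_{m\in\mathbb Z_{\ge0}^d}q^{L(L-2m_1)+m^TCm}\begin{bmatrix}L+M+m_1\\ 2L\end{bmatrix}\prod_{j=1}^d\begin{bmatrix}\tau_jm_j+n_j\\ \tau_jm_j\end{bmatrix}$. *)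

(* Defs.v *)
From mathcomp Require Import all_boot all_order all_algebra.
Set Implicit Arguments. Unset Strict Implicit. Unset Printing Implicit Defensive.
Import Order.TTheory GRing.Theory Num.Theory.
Local Open Scope ring_scope.

Definition qpochx (R : fieldType) (x q : R) (n : nat) : R :=
  \prod_(i < n) (1 - x * q ^+ i).
Definition qpoch (R : fieldType) (q : R) (n : nat) : R := qpochx q q n.

Definition qbin (R : fieldType) (q : R) (n m : int) : R :=
  if (0 <= m) && (0 <= n - m) then
    qpoch q `|n|%N / (qpoch q `|m|%N * qpoch q `|n - m|%N)
  else 0.

Definition qB (R : fieldType) (q : R) (L M a b : int) : R :=
  qbin q (L + M + a - b) (L + a) * qbin q (L + M - a + b) (L - a).

Definition cfval (a b : nat) : rat :=
  if (2 * b < a)%N then (a%:R / b%:R - 1)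
  else if (a < 2 * b)%N then (a%:R / b%:R - 1)^-1
  else 1.

Fixpoint cf_value (s : seq nat) : rat :=
  match s with
  | [::] => 0
  | [:: x] => x%:R
  | x :: s' => x%:R + (cf_value s')^-1
  end.

Definition is_cf_rep (a b : nat) (cfl : seq nat) : Prop :=
  [/\ cfl <> [::], all (fun x => 0 < x)%N cfl, cf_value cfl = cfval a b &
      (if (a == 2%N) && (b == 1%N) then cfl = [:: 1%N] else (2 <= last 0 cfl)%N)].

Definition cf_d (cfl : seq nat) : nat := sumn cfl.
Definition cf_t (cfl : seq nat) : seq nat :=
  [seq sumn (take j cfl) | j <- iota 1 (size cfl)].

Definition dlt (j k : nat) : int := ((j == k : nat))%:Z.

(* the matrix \mathcal I (1-based indices j,k in 1..d) *)
Definition cf_I (cfl : seq nat) (j k : nat) : int :=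
  if j \in cf_t cfl then dlt j k.+1 + dlt j k - dlt j.+1 k
  else dlt j k.+1 + dlt j.+1 k.

Definition cf_C (cfl : seq nat) (j k : nat) : int :=
  2 * dlt j k - cf_I cfl j k.

Definition cf_tau (cfl : seq nat) (j : nat) : nat :=
  if (j < cf_d cfl)%N then 2%N else 1%N.

Definition mCm (cfl : seq nat) (m : nat -> nat) : int :=
  \sum_(1 <= j < (cf_d cfl).+1) \sum_(1 <= k < (cf_d cfl).+1)
     (m j)%:Z * cf_C cfl j k * (m k)%:Z.

Definition cf_n (cfl : seq nat) (L : nat) (m : nat -> nat) (j : nat) : int :=
  L%:Z * dlt j 1 - \sum_(1 <= k < (cf_d cfl).+1) cf_C cfl j k * (m k)%:Z.

Definition prod_factor (R : fieldType) (q : R) (cfl : seq nat) (L : nat)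
    (m : nat -> nat) : R :=
  \prod_(1 <= j < (cf_d cfl).+1)
     qbin q ((cf_tau cfl j * m j)%N%:Z + cf_n cfl L m j) (cf_tau cfl j * m j)%N.

Definition F_term (R : fieldType) (q : R) (a b : nat) (cfl : seq nat)
    (L M : nat) (m : nat -> nat) : R :=
  if (a <= 2 * b)%N then
    q ^ mCm cfl m * qbin q (2 * L%:Z + M%:Z - (m 1%N)%:Z) (2 * L%:Z)
      * prod_factor q cfl L m
  else
    q ^ (L%:Z * (L%:Z - 2 * (m 1%N)%:Z) + mCm cfl m)
      * qbin q (L%:Z + M%:Z + (m 1%N)%:Z) (2 * L%:Z)
      * prod_factor q cfl L m.

(* the summand of the left-hand side at j \in Z.  The exponent
   (1/2) j((2ab+1)j+1) is an (even-numerator) integer, written with int division *)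
Definition lhs_term (R : fieldType) (q : R) (a b L M : nat) (j : int) : R :=
  (-1) ^ j * q ^ ((j * ((2 * a * b + 1)%N%:Z * j + 1)) %/ 2)%Z
    * qB q L%:Z M%:Z (a%:Z * j) (b%:Z * j).

Definition zsum_trunc (R : fieldType) (f : int -> R) (N : nat) : R :=
  \sum_(i < (2 * N).+1) f (i%:Z - N%:Z).
Definition zsum_is (R : fieldType) (f : int -> R) (s : R) : Prop :=
  exists N0 : nat, forall N : nat, (N0 <= N)%N -> zsum_trunc f N = s.

(* a function 'I_d -> 'I_N.+1 viewed as m = (m_1, ..., m_d) (1-based, 0 elsewhere) *)
Definition ffun_to_m (d N : nat) (f : {ffun 'I_d -> 'I_N.+1}) (j : nat) : nat :=
  match j with
  | 0 => 0
  | k.+1 => match (insub k : option 'I_d) with Some i => val (f i) | None => 0 end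
  end.
Definition box_trunc (R : fieldType) (d : nat) (g : (nat -> nat) -> R) (N : nat) : R :=
  \sum_(f : {ffun 'I_d -> 'I_N.+1}) g (ffun_to_m f).
Definition boxsum_is (R : fieldType) (d : nat) (g : (nat -> nat) -> R) (s : R) : Prop :=
  exists N0 : nat, forall N : nat, (N0 <= N)%N -> box_trunc d g N = s.

(* Main.v *)
(* For [G_(a,b)(L,M)] the left-hand side, the Burge transform, a termwise
   application of the q-Saalschuetz sum, expresses both [G_(a+b,b)(L,M)] and
   [G_(a+b,a)(L,M)] as a weighted sum over [m] of [G_(a,b)(m, L - m)].  Running
   this backwards from (a,b) is the subtractive Euclidean algorithm, hence
   follows the continued fraction digit by digit: each step strips the first
   row and column of C (an entry of some [t_j] marks the step exchanging the
   two arguments) and it ends at (1,1), where a q-Dixon type sum gives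
   [G_(1,1)(L,M) = [L+M; L]]. *)
Require Import Defs.
From mathcomp Require Import all_boot all_order all_algebra.
From mathcomp Require Import zify ring.
Import Order.TTheory GRing.Theory Num.Theory.
Local Open Scope ring_scope.

Set Implicit Arguments.
Unset Strict Implicit.

(** * Reindexing and truncating finite sums *)

Lemma sum_ord_geq (V : nmodType) (n k : nat) (F : nat -> V) :
  (k <= n)%N -> \sum_(s < n.+1 | (k <= s)%N) F s = \sum_(j < (n - k).+1) F (j + k)%N.
Proof.
by move=> kn; rewrite -(big_geq_mkord _ _ xpredT F) -{1}[k]add0n big_addn big_mkord subSn.
Qed.

Lemma sum_ord_trunc (V : nmodType) (m n : nat) (F : nat -> V) :
  (m <= n)%N -> (forall k, (m <= k)%N -> F k = 0) -> \sum_(k < n) F k = \sum_(k < m) F k.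
Proof.
move=> mn F0; rewrite -(big_mkord xpredT) (big_cat_nat (n := m)) //= big_mkord.
by rewrite [X in _ + X]big_nat [X in _ + X]big1 ?addr0 // => k /andP[mk _]; exact: F0.
Qed.

Definition lhs_exp (a b : nat) (j : int) : int :=
  ((j * ((2 * a * b + 1)%N%:Z * j + 1)) %/ 2)%Z.

(** * The matrix of a continued fraction *)

Lemma cf_t_cons (x : nat) (s : seq nat) : cf_t (x :: s) = x :: map (addn x) (cf_t s).
Proof.
rewrite /cf_t /= take0 addn0 -[2%N]/(1 + 1)%N iotaDl -!map_comp; congr (_ :: _).
Qed.

Lemma cf_t_succ (x : nat) (s : seq nat) : cf_t (x.+1 :: s) = map S (cf_t (x :: s)).
Proof. by rewrite !cf_t_cons /= -map_comp; congr (_ :: _); apply: eq_map. Qed.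

Lemma cf_t_one (s : seq nat) : cf_t (1%N :: s) = 1%N :: map S (cf_t s).
Proof. by rewrite cf_t_cons. Qed.

Lemma mem_map_succ (k : nat) (T : seq nat) : (k.+1 \in map S T) = (k \in T).
Proof. by rewrite mem_map // => i j []. Qed.

(* [s'] describes the matrix of [s] with its first row and column removed. *)
Definition cf_minor (s s' : seq nat) : Prop :=
  [/\ cf_d s = (cf_d s').+1, (0 < cf_d s')%N &
      forall k, (k.+2 \in cf_t s) = (k.+1 \in cf_t s')].

Lemma cf_minor_succ (x : nat) (s : seq nat) : cf_minor (x.+2 :: s) (x.+1 :: s).
Proof. by split=> // k; rewrite cf_t_succ mem_map_succ. Qed.

Lemma cf_minor_one (s : seq nat) : (0 < cf_d s)%N -> cf_minor (1%N :: s) s.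
Proof. by split=> // k; rewrite cf_t_one inE /= mem_map_succ. Qed.

Lemma one_notin_cf_t (x : nat) (s : seq nat) : 1%N \notin cf_t (x.+2 :: s).
Proof. by rewrite cf_t_succ mem_map_succ cf_t_succ; apply/mapP => -[]. Qed.

Lemma one_in_cf_t (s : seq nat) : 1%N \in cf_t (1%N :: s).
Proof. by rewrite cf_t_one inE. Qed.

Definition mcons (x : nat) (m : nat -> nat) (j : nat) : nat :=
  match j with 0 => 0 | 1 => x | k.+2 => m k.+1 end.

Lemma big_nat_first (T : Type) (idx : T) (op : T -> T -> T) (d : nat) (F : nat -> T) :
  \big[op/idx]_(1 <= k < d.+2) F k = op (F 1%N) (\big[op/idx]_(1 <= k < d.+1) F k.+1).
Proof. by rewrite big_ltn // big_add1. Qed.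

Section Minor.
Variables (s s' : seq nat).
Hypothesis ss' : cf_minor s s'.

Lemma cf_C_minor (j k : nat) : cf_C s j.+2 k.+2 = cf_C s' j.+1 k.+1.
Proof. by case: ss' => _ _ t; rewrite /cf_C /cf_I t /dlt !eqSS. Qed.

(** Below the diagonal both branches of [cf_I] agree, so the first column ignores the positions
    [t_j]. *)
Lemma cf_C_col (j : nat) : cf_C s j.+2 1 = - dlt j.+1 1.
Proof. by rewrite /cf_C /cf_I /dlt !eqSS; case: ifP; case: eqP; lia. Qed.

Lemma row_minor (x : nat) (m : nat -> nat) (j : nat) :
  \sum_(1 <= k < (cf_d s).+1) cf_C s j.+2 k * (mcons x m k)%:Z
  = - (x%:Z * dlt j.+1 1) + \sum_(1 <= k < (cf_d s').+1) cf_C s' j.+1 k * (m k)%:Z.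
Proof.
case: (ss') => -> _ _; rewrite big_nat_first cf_C_col mulNr mulrC; congr (_ + _).
by rewrite !big_nat; apply: eq_bigr => -[|k] // _; rewrite cf_C_minor.
Qed.

Lemma row_first (x : nat) (m : nat -> nat) :
  \sum_(1 <= k < (cf_d s).+1) cf_C s 1 k * (mcons x m k)%:Z
  = cf_C s 1 1 * x%:Z + cf_C s 1 2 * (m 1%N)%:Z.
Proof.
case: (ss') => -> d0 _; rewrite big_nat_first; congr (_ + _).
rewrite -(prednK d0) big_nat_first big_nat big1 ?addr0 // => -[|k] // _.
by rewrite /cf_C /cf_I /dlt /=; case: ifP.
Qed.

(** The first row is paired with [x]; the first column adds only [- x * m 1], whence the [- 1] next
    to [cf_C s 1 2]. *)
Lemma mCm_minor (x : nat) (m : nat -> nat) :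
  mCm s (mcons x m)
  = (cf_C s 1 1 * x%:Z + (cf_C s 1 2 - 1) * (m 1%N)%:Z) * x%:Z + mCm s' m.
Proof.
have mCmE t n : mCm t n = \sum_(1 <= j < (cf_d t).+1)
    (n j)%:Z * \sum_(1 <= k < (cf_d t).+1) cf_C t j k * (n k)%:Z.
  by apply: eq_bigr => j _; rewrite big_distrr; apply: eq_bigr => k _; rewrite /= mulrA.
rewrite !mCmE; case: (ss') => d_s d0 _.
pose row j := \sum_(1 <= k < (cf_d s).+1) cf_C s j k * (mcons x m k)%:Z.
transitivity (\sum_(1 <= j < (cf_d s).+1) (mcons x m j)%:Z * row j); first by [].
rewrite d_s big_nat_first [row 1%N]row_first.
have -> : \sum_(1 <= j < (cf_d s').+1) (mcons x m j.+1)%:Z * row j.+1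
    = \sum_(1 <= j < (cf_d s').+1) (- ((m j)%:Z * x%:Z * dlt j 1) +
       (m j)%:Z * \sum_(1 <= k < (cf_d s').+1) cf_C s' j k * (m k)%:Z).
  by rewrite !big_nat; apply: eq_bigr => -[|j] // _; rewrite /row row_minor //=; ring.
rewrite big_split /= -[in X in _ + (X + _)](prednK d0) big_nat_first [X in _ + (_ + X + _)]big_nat.
rewrite [X in _ + (_ + X + _)]big1; last by move=> [|j] // _; rewrite /dlt /=; ring.
by rewrite /dlt /=; ring.
Qed.

Lemma cf_n_first (L x : nat) (m : nat -> nat) :
  cf_n s L (mcons x m) 1 = L%:Z - (cf_C s 1 1 * x%:Z + cf_C s 1 2 * (m 1%N)%:Z).
Proof. by rewrite /cf_n row_first mulr1. Qed.

(** The column entry [-1] feeds [x] into the first row of the minor, so [x] takes over the role of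
    [L] there; this closes the recursion. *)
Lemma cf_n_minor (L x : nat) (m : nat -> nat) (j : nat) :
  cf_n s L (mcons x m) j.+2 = cf_n s' x m j.+1.
Proof. by rewrite /cf_n row_minor /dlt /=; ring. Qed.

Lemma prod_factor_minor (R : fieldType) (q : R) (L x : nat) (m : nat -> nat) :
  prod_factor q s L (mcons x m) =
  qbin q ((2 * x)%N%:Z + cf_n s L (mcons x m) 1) (2 * x)%N * prod_factor q s' x m.
Proof.
rewrite /prod_factor; case: (ss') => d_s d0 _; rewrite d_s big_nat_first; congr (_ * _).
  (* The minor is nonempty, so index 1 is not the last one and its [tau] is 2. *)
  by rewrite /cf_tau d_s ltnS d0.
rewrite !big_nat; apply: eq_bigr => -[|j] // _.
by rewrite cf_n_minor /cf_tau d_s ltnS.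
Qed.

End Minor.

(** The square of [m 1] is taken out of the exponent because the outer Burge kernel supplies it, as
    [m_1^2] or completed to [(L - m_1)^2]. *)
Definition cf_weight (R : fieldType) (q : R) (s : seq nat) (L : nat) (m : nat -> nat) : R :=
  q ^ (mCm s m - (m 1%N)%:Z ^+ 2) * prod_factor q s L m.

Lemma eq_cf_weight (R : fieldType) (q : R) (s : seq nat) (L : nat) (m m' : nat -> nat) :
  m =1 m' -> cf_weight q s L m = cf_weight q s L m'.
Proof.
move=> mm'; rewrite /cf_weight /prod_factor mm'; congr (_ ^ (_ - _) * _).
  by apply: eq_bigr => j _; apply: eq_bigr => k _; rewrite !mm'.
apply: eq_bigr => j _; rewrite mm' /cf_n; congr (qbin _ (_ + (_ - _)) _).
by apply: eq_bigr => k _; rewrite mm'.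
Qed.

(** * Box sums, one coordinate at a time *)

Lemma box_trunc_cons (R : fieldType) (d N : nat) (g : (nat -> nat) -> R) :
  (forall m m', m =1 m' -> g m = g m') ->
  box_trunc d.+1 g N = \sum_(x < N.+1) box_trunc d (fun m => g (mcons x m)) N.
Proof.
move=> g_ext; rewrite /box_trunc pair_bigA /=.
pose h (p : 'I_N.+1 * {ffun 'I_d -> 'I_N.+1}) : {ffun 'I_d.+1 -> 'I_N.+1} :=
  [ffun k => oapp p.2 p.1 (unlift ord0 k)].
pose h' (f : {ffun 'I_d.+1 -> 'I_N.+1}) : 'I_N.+1 * {ffun 'I_d -> 'I_N.+1} :=
  (f ord0, [ffun k => f (lift ord0 k)]).
rewrite (reindex h) /=; last first.
  exists h' => [[x f] _|f _].
    rewrite /h' /h ffunE unlift_none /=; congr pair; apply/ffunP => k.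
    by rewrite !ffunE liftK.
  by apply/ffunP => k; rewrite ffunE /h' /=; case: unliftP => [j|] -> //=; rewrite ffunE.
(* The two encodings of [m] agree only pointwise, with default 0 outside the box, hence the
   extensionality hypothesis on [g]. *)
apply: eq_bigr => -[x f] _ /=; apply: g_ext => -[|[|k]] //=.
  case: insubP => [i _ i0|] //; rewrite ffunE (_ : i = ord0) ?unlift_none //.
  exact: val_inj.
case: insubP => [i kd ik|]; last first.
  by case: insubP => // i kd _; rewrite ltnS kd.
rewrite ltnS in kd; rewrite (insubT (fun j => j < d)%N kd) ffunE.
rewrite (_ : i = lift ord0 (Ordinal kd)) ?liftK //.
by apply: val_inj; rewrite ik.
Qed.

Lemma box_trunc1 (R : fieldType) (N : nat) (g : (nat -> nat) -> R) :
  (forall m m', m =1 m' -> g m = g m') ->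
  box_trunc 1 g N = \sum_(x < N.+1) g (mcons x (fun => 0%N)).
Proof.
move=> g_ext; rewrite box_trunc_cons //; apply: eq_bigr => x _.
rewrite /box_trunc (big_pred1 [ffun=> ord0]) => [|f]; last first.
  by apply/esym/eqP/ffunP => -[].
by apply: g_ext => -[|[|k]] //=; case: insubP.
Qed.

(** * Values of continued fractions *)

Lemma cf_value_gt0 (s : seq nat) :
  s <> [::] -> all (fun x => 0 < x)%N s -> 0 < cf_value s.
Proof.
elim: s => // x [|y s] IH _ /andP[x0 s0]; first by rewrite /= ltr0n.
by rewrite [cf_value _]/= addr_gt0 ?ltr0n // invr_gt0 IH.
Qed.

Lemma cf_value_succ (x : nat) (s : seq nat) :
  cf_value (x.+1 :: s) = 1 + cf_value (x :: s).
Proof. by case: s => [|y s]; rewrite /= -natr1 [_ + 1]addrC ?addrA. Qed.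
(** * q-binomials and the q-Saalschuetz sum *)

Section QBinomial.
Variables (R : fieldType) (q : R).
Hypothesis hq0 : q != 0.
Hypothesis hq : forall n : nat, (0 < n)%N -> q ^+ n != 1.

Lemma qpochS n : qpoch q n.+1 = qpoch q n * (1 - q ^+ n.+1).
Proof. by rewrite /qpoch /qpochx big_ord_recr /= exprS. Qed.

Lemma qpoch0 : qpoch q 0 = 1.
Proof. by rewrite /qpoch /qpochx big_ord0. Qed.

Lemma qfactor_neq0 n : 1 - q ^+ n.+1 != 0.
Proof. by rewrite subr_eq0 eq_sym hq. Qed.

Lemma qpoch_neq0 n : qpoch q n != 0.
Proof.
elim: n => [|n IH]; first by rewrite qpoch0 oner_neq0.
by rewrite qpochS mulf_neq0 // qfactor_neq0.
Qed.

Lemma qbin_neg (n k : int) : k < 0 -> qbin q n k = 0.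
Proof. by move=> h; rewrite /qbin ifF //; lia. Qed.

Lemma qbin_small (n k : int) : n < k -> qbin q n k = 0.
Proof. by move=> h; rewrite /qbin ifF //; lia. Qed.

Lemma qbin_sym (n k : int) : qbin q n (n - k) = qbin q n k.
Proof.
rewrite /qbin opprB addrC subrK andbC [RHS]/= [qpoch q _ * qpoch q _]mulrC.
by case: ifP.
Qed.

Lemma qbin_addE (k l : nat) :
  qbin q (k%:Z + l%:Z) k = qpoch q (k + l) / (qpoch q k * qpoch q l).
Proof.
rewrite /qbin ifT; last by lia.
by have -> : k%:Z + l%:Z - k%:Z = l by lia.
Qed.

Lemma qbin0 (n : nat) : qbin q n 0 = 1.
Proof.
have := qbin_addE 0 n; rewrite add0r add0n qpoch0 mul1r => ->.
by rewrite divff // qpoch_neq0.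
Qed.

Lemma qbinn (n : nat) : qbin q n n = 1.
Proof. by rewrite -qbin_sym subrr qbin0. Qed.

Lemma qbinS (n : nat) (k : int) :
  qbin q n.+1 k = qbin q n (k - 1) + q ^ k * qbin q n k.
Proof.
case: (ltrP k 0) => [k0|]; first by rewrite !qbin_neg ?mulr0 ?addr0 //; lia.
case: k => // [[|k]] _.
  by rewrite !qbin0 (@qbin_neg _ (0 - 1)) // add0r expr0z mul1r.
have -> : Posz k.+1 - 1 = k by lia.
case: (ltngtP n k) => [nk|kn|->].
- by rewrite !qbin_small ?mulr0 ?addr0 //; lia.
- have [l def_n] : exists l, n = (k + l.+1)%N by exists (n - k.+1)%N; lia.
  rewrite {}def_n.
  have -> : Posz (k + l.+1).+1 = k.+1%:Z + l.+1%:Z by lia.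
  rewrite qbin_addE PoszD qbin_addE.
  have -> : Posz k + l.+1 = k.+1%:Z + l%:Z by lia.
  rewrite qbin_addE addSnnS !addnS !qpochS -[q ^ Posz k.+1]/(q ^+ k.+1).
  have -> : q ^+ (k + l).+2 = q ^+ k.+1 * q ^+ l.+1 by rewrite -exprD addSn addnS.
  have hk := qpoch_neq0 k; have hl := qpoch_neq0 l.
  have hkS := qfactor_neq0 k; have hlS := qfactor_neq0 l.
  by field; rewrite hk hl hkS hlS.
- by rewrite !qbinn qbin_small ?mulr0 ?addr0 //; lia.
Qed.

Lemma qbinS' (n : nat) (k : int) :
  qbin q n.+1 k = qbin q n k + q ^ (n.+1%:Z - k) * qbin q n (k - 1).
Proof.
rewrite -qbin_sym qbinS; congr (_ + _ * _); rewrite -[RHS]qbin_sym; congr qbin; lia.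
Qed.

(** Induction on [n]: [qbinS'] splits the left side and the second binomial of each summand, and the
    two halves match separately. *)
Lemma qVandermonde (m n k : nat) :
  qbin q (m%:Z + n%:Z) k =
  \sum_(j < k.+1) q ^ ((m%:Z - j%:Z) * (k%:Z - j%:Z)) *
                  (qbin q m j * qbin q n (k%:Z - j%:Z)).
Proof.
elim: n k => [|n IH] k.
  rewrite addr0 big_ord_recr /= subrr mulr0 expr0z mul1r qbinn mulr1 big1 ?add0r // => j _.
  by rewrite (qbin_small (n := 0)) ?mulr0 //; have := ltn_ord j; lia.
case: k => [|k].
  by rewrite big_ord_recr big_ord0 /= subrr mulr0 expr0z mul1r -PoszD !qbin0 add0r mulr1.
rewrite -PoszD addnS qbinS' PoszD IH (_ : k.+1%:Z - 1 = k); last by lia.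
rewrite IH big_distrr /=.
under [RHS]eq_bigr => j _ do rewrite qbinS' (mulrDr (qbin _ _ _)) (mulrDr (q ^ _)).
rewrite big_split /=; congr (_ + _).
rewrite [RHS]big_ord_recr /= (_ : k.+1%:Z - k.+1%:Z - 1 = - 1); last by lia.
rewrite (@qbin_neg _ (-1)) // !mulr0 addr0; apply: eq_bigr => j _.
rewrite (_ : k.+1%:Z - j%:Z - 1 = k%:Z - j%:Z); last by lia.
rewrite (mulrCA (qbin _ _ _) (q ^ _)) !(mulrA (q ^ _) (q ^ _)) -!expfzDr //.
by congr (_ ^ _ * _); lia.
Qed.

Lemma qVandermonde' (m n k : nat) :
  qbin q (m%:Z + n%:Z) k =
  \sum_(j < k.+1) q ^ (j%:Z * (n%:Z - k%:Z + j%:Z)) *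
                  (qbin q m j * qbin q n (k%:Z - j%:Z)).
Proof.
rewrite addrC qVandermonde (reindex_inj rev_ord_inj) /=; apply: eq_bigr => j _.
have -> : Posz (k.+1 - j.+1) = k%:Z - j%:Z by have := ltn_ord j; lia.
have -> : k%:Z - (k%:Z - j%:Z) = j by lia.
by rewrite mulrC [qbin _ _ _ * _]mulrC mulrC; congr (_ ^ _ * _); lia.
Qed.

(* Both sides vanish unless [j <= l <= n]. *)
Lemma qbin_qbin (n l j : nat) :
  (j <= l)%N ->
  qbin q n l * qbin q l j = qbin q n j * qbin q (n%:Z - j%:Z) (l%:Z - j%:Z).
Proof.
move=> jl; case: (leqP l n) => ln; last first.
  by rewrite qbin_small ?(@qbin_small (_ - _)) ?mul0r ?mulr0 //; lia.
have [x def_l] : exists x, l = (j + x)%N by exists (l - j)%N; lia.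
have [y def_n] : exists y, n = (l + y)%N by exists (n - l)%N; lia.
rewrite (_ : n%:Z - j%:Z = x%:Z + y%:Z) 1?(_ : l%:Z - j%:Z = x); try lia.
rewrite (_ : qbin q n l = qpoch q (l + y) / (qpoch q l * qpoch q y)); last first.
  by rewrite def_n PoszD qbin_addE.
rewrite (_ : qbin q n j = qpoch q (l + y) / (qpoch q j * qpoch q (x + y))); last first.
  by rewrite def_n def_l -addnA PoszD qbin_addE.
rewrite def_l PoszD !qbin_addE.
have := qpoch_neq0 (j + x); have := qpoch_neq0 (x + y); have := qpoch_neq0 j.
have := qpoch_neq0 x; have := qpoch_neq0 y => h1 h2 h3 h4 h5.
by field; rewrite h1 h2 h3 h4 h5.
Qed.

(** With [B = k + c + x], Vandermonde expands the second binomial over [j]; setting [s = j + k],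
    [qbin_qbin] confines [k] to a single binomial, so that it can be summed out in [qSaalschutz]. *)
Lemma qbin_Vandermonde (A B n c k : nat) :
  (k <= n)%N ->
  qbin q B (k%:Z + c%:Z) * qbin q (A%:Z + B%:Z + n%:Z - k%:Z) (n%:Z - k%:Z)
  = \sum_(s < n.+1 | (k <= s)%N)
      q ^ ((B%:Z - c%:Z - s%:Z) * (n%:Z - s%:Z)) * qbin q B (s%:Z + c%:Z)
      * qbin q (s%:Z + c%:Z) (s%:Z - k%:Z) * qbin q (A%:Z + n%:Z + c%:Z) (n%:Z - s%:Z).
Proof.
move=> kn; case: (leqP (k + c) B) => kcB; last first.
  rewrite qbin_small ?mul0r; last by lia.
  by rewrite big1 // => s ks; rewrite qbin_small ?mulr0 ?mul0r //; lia.
have [x def_B] : exists x, B = (k + c + x)%N by exists (B - (k + c))%N; lia.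
rewrite (_ : A%:Z + B%:Z + n%:Z - k%:Z = x%:Z + (A + n + c)%N%:Z); last by lia.
rewrite (_ : n%:Z - k%:Z = (n - k)%N); last by lia.
rewrite (sum_ord_geq (fun s : nat => q ^ ((B%:Z - c%:Z - s%:Z) * (n%:Z - s%:Z)) *
  qbin q B (s%:Z + c%:Z) * qbin q (s%:Z + c%:Z) (s%:Z - k%:Z) *
  qbin q (A%:Z + n%:Z + c%:Z) (n%:Z - s%:Z)) kn) qVandermonde big_distrr /=.
apply: eq_bigr => j _; have := ltn_ord j => jn.
rewrite (_ : B%:Z - c%:Z - (j + k)%N%:Z = x%:Z - j%:Z); last by lia.
rewrite (_ : n%:Z - (j + k)%N%:Z = (n - k)%N%:Z - j%:Z); last by lia.
rewrite -[_ * _ * _ * _]mulrA -[_ * _ * (_ * _)]mulrA mulrCA; congr (_ * _).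
rewrite !PoszD !mulrA; congr (_ * _).
rewrite -(qbin_sym (j%:Z + k%:Z + c%:Z)).
have -> : j%:Z + k%:Z + c%:Z - (j%:Z + k%:Z - k%:Z) = (k + c)%N by lia.
have -> : j%:Z + k%:Z + c%:Z = (j + k + c)%N by lia.
rewrite qbin_qbin ?PoszD; last by lia.
by congr (_ * qbin _ _ _); lia.
Qed.

(** After expansion by [qbin_Vandermonde] and exchange of sums, the sum over [k] and then the sum
    over [s] are both Vandermonde sums. *)
Lemma qSaalschutz (A B n c : nat) :
  \sum_(k < n.+1) q ^ (k%:Z * (k%:Z + c%:Z)) *
     (qbin q A k * qbin q B (k%:Z + c%:Z) * qbin q (A%:Z + B%:Z + n%:Z - k%:Z) (n%:Z - k%:Z))
  = qbin q (A%:Z + n%:Z + c%:Z) n * qbin q (B%:Z + n%:Z) (n%:Z + c%:Z).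
Proof.
transitivity (\sum_(s < n.+1) \sum_(k < n.+1 | (k <= s)%N)
  q ^ ((B%:Z - c%:Z - s%:Z) * (n%:Z - s%:Z)) * qbin q B (s%:Z + c%:Z)
    * qbin q (A%:Z + n%:Z + c%:Z) (n%:Z - s%:Z) *
  (q ^ (k%:Z * (k%:Z + c%:Z)) * (qbin q A k * qbin q (s%:Z + c%:Z) (s%:Z - k%:Z)))).
  rewrite (exchange_big_dep predT) //=; apply: eq_bigr => k _.
  rewrite -mulrA qbin_Vandermonde; last by have := ltn_ord k; lia.
  by rewrite !big_distrr /=; apply: eq_bigr => s _; ring.
have inner (s : 'I_n.+1) : \sum_(k < n.+1 | (k <= s)%N)
    q ^ (k%:Z * (k%:Z + c%:Z)) * (qbin q A k * qbin q (s%:Z + c%:Z) (s%:Z - k%:Z))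
    = qbin q (A%:Z + (s + c)%N%:Z) s.
  rewrite qVandermonde' (big_ord_widen n.+1 (fun j : nat =>
    q ^ (j%:Z * ((s + c)%N%:Z - s%:Z + j%:Z)) * (qbin q A j * qbin q (s + c)%N (s%:Z - j%:Z)))) //.
  apply: eq_bigr => k _; rewrite -PoszD; congr (_ ^ _ * _); lia.
under eq_bigr => s _ do rewrite -big_distrr /= inner.
(* The right side is expanded too; its terms with [j < c] vanish and [j = s + c] aligns the rest. *)
rewrite (_ : n%:Z + c%:Z = (n + c)%N) // qVandermonde.
rewrite (bigID (fun j : 'I_(n + c).+1 => (c <= j)%N)) /= [X in _ * (_ + X)]big1 ?addr0; last first.
  by move=> j; rewrite -ltnNge => jc; rewrite (@qbin_small n) ?mulr0 //; lia.
rewrite (sum_ord_geq (fun j : nat => q ^ ((B%:Z - j%:Z) * ((n + c)%N%:Z - j%:Z)) *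
  (qbin q B j * qbin q n ((n + c)%N%:Z - j%:Z))) (leq_addl n c)) addnK.
rewrite big_distrr /=; apply: eq_bigr => s _; have := ltn_ord s => sn.
rewrite (_ : B%:Z - (s + c)%N%:Z = B%:Z - c%:Z - s%:Z); last by lia.
rewrite (_ : (n + c)%N%:Z - (s + c)%N%:Z = n%:Z - s%:Z); last by lia.
rewrite -!mulrA [RHS]mulrCA; congr (_ * _); rewrite [RHS]mulrCA; congr (_ * _).
(* Both products of two binomials are the same q-trinomial coefficient, so [qbin_qbin] brings them
   to a common form. *)
rewrite (qbin_sym n) (_ : A%:Z + n%:Z + c%:Z = (A + n + c)%N) // qbin_qbin //.
rewrite -qbin_sym (_ : _ - (n%:Z - s%:Z) = (A + (s + c))%N) -?PoszD ?qbin_qbin; try lia.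
by congr (_ * _); rewrite -[RHS]qbin_sym; congr qbin; lia.
Qed.

(** * The Burge transform *)

Lemma qB_sym (L M a b : int) : qB q L M a b = qB q M L b a.
Proof.
rewrite /qB mulrC -qbin_sym -[qbin q (L + M + a - b) _]qbin_sym.
by congr (qbin _ _ _ * qbin _ _ _); lia.
Qed.

Lemma qB_opp (L M a b : int) : qB q L M (- a) (- b) = qB q L M a b.
Proof. by rewrite /qB mulrC !opprK. Qed.

Lemma qB_neg (L M a b : int) : M < 0 -> qB q L M a b = 0.
Proof.
move=> M0; rewrite /qB; case: (lerP 0 b) => b0.
  by rewrite qbin_small ?mul0r //; lia.
by rewrite (@qbin_small (_ + b)) ?mulr0 //; lia.
Qed.

(** The shift [i = k + b] gives [qSaalschutz] with [n = M - b], [A = L + a - b], [B = L - a + b],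
    [c = 2b]; the prefactor comes from [i^2 = k(k + 2b) + b^2]. *)
Lemma Burge_nat (N L a b : nat) (M : int) : (L <= N)%N ->
  \sum_(i < N.+1) q ^ (i%:Z ^+ 2) * qbin q (2 * L%:Z + M - i%:Z) (2 * L%:Z)
     * qB q (L%:Z - i%:Z) i a b
  = q ^ (b%:Z ^+ 2) * qB q L M (a%:Z + b%:Z) b.
Proof.
(* Unless [a + b <= L] and [b <= M], both sides vanish term by term; otherwise [A], [B] and [n] are
   naturals. *)
move=> LN; case: (leqP (a + b) L) => abL; last first.
  rewrite /qB (@qbin_neg _ (L%:Z - (a%:Z + b%:Z))) ?mulr0; last by lia.
  rewrite big1 // => i _; case: (ltrP (L%:Z - i%:Z - a%:Z) 0) => h.
    by rewrite (qbin_neg _ h) !mulr0.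
  by rewrite (@qbin_small _ (L%:Z - i%:Z + a%:Z)) ?mul0r ?mulr0 //; lia.
case: (ltrP M b) => Mb.
  rewrite /qB (@qbin_small _ (L%:Z + (a%:Z + b%:Z))) ?mul0r ?mulr0; last by lia.
  rewrite big1 // => i _; case: (ltrP M i) => h.
    by rewrite qbin_small ?mulr0 ?mul0r //; lia.
  by rewrite (@qbin_small _ (L%:Z - i%:Z + a%:Z)) ?mul0r ?mulr0 //; lia.
have [n def_M] : exists n : nat, M = n%:Z + b%:Z by exists `|M - b|%N; lia.
have [A def_A] : exists A : nat, A%:Z = L%:Z + a%:Z - b%:Z by exists (L + a - b)%N; lia.
have [B def_B] : exists B : nat, B%:Z = L%:Z - a%:Z + b%:Z by exists (L + b - a)%N; lia.
set F := fun i : nat => q ^ (i%:Z ^+ 2) * qbin q (2 * L%:Z + M - i%:Z) (2 * L%:Z)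
  * qB q (L%:Z - i%:Z) i a b.
have F0 i : (L < i)%N -> F i = 0.
  by move=> Li; rewrite /F /qB (@qbin_neg _ (L%:Z - i%:Z - a%:Z)) ?mulr0 //; lia.
(* The range is padded with zeros so that, once [i < b] is dropped, it matches the Saalschuetz sum
   padded to [n + N]. *)
rewrite -(@sum_ord_trunc _ N.+1 (n + N + b).+1 F); [|lia|by move=> k hk; apply: F0; lia].
rewrite (bigID (fun i : 'I_(_).+1 => (b <= i)%N)) /= [X in _ + X]big1 ?addr0; last first.
  move=> i; rewrite -ltnNge => ib.
  by rewrite /F /qB (@qbin_small _ (L%:Z - i%:Z + a%:Z)) ?mul0r ?mulr0 //; lia.
rewrite (sum_ord_geq F (leq_addl _ _)) addnK.
have -> : qB q L M (a%:Z + b%:Z) b = qbin q (A%:Z + n%:Z + (2 * b)%N%:Z) n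
    * qbin q (B%:Z + n%:Z) (n%:Z + (2 * b)%N%:Z).
  rewrite /qB -qbin_sym -[qbin q (_ + b%:Z) _]qbin_sym.
  by congr (qbin _ _ _ * qbin _ _ _); lia.
rewrite -qSaalschutz -[RHS]/(_ * \sum_(k < n.+1) _) -(@sum_ord_trunc _ n.+1 (n + N).+1
 (fun k : nat => q ^ (k%:Z * (k%:Z + (2 * b)%N%:Z)) *
     (qbin q A k * qbin q B (k%:Z + (2 * b)%N%:Z) *
      qbin q (A%:Z + B%:Z + n%:Z - k%:Z) (n%:Z - k%:Z)))).
- rewrite big_distrr /=; apply: eq_bigr => k _.
  rewrite [RHS]mulrA -expfzDr // /F /qB -!mulrA; congr (_ * _); first by congr (_ ^ _); lia.
  rewrite mulrC -mulrA -[qbin _ A k]qbin_sym -[qbin _ B _]qbin_sym.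
  rewrite -[in RHS](qbin_sym (A%:Z + B%:Z + n%:Z - k%:Z)).
  by congr (qbin _ _ _ * (qbin _ _ _ * qbin _ _ _)); lia.
- by lia.
- by move=> k nk; rewrite (@qbin_neg _ (n%:Z - k%:Z)) ?mulr0 //; lia.
Qed.

(* The transform needs both arguments of [qB] to have the same sign, which the
   common factor [j] ensures. *)
Lemma Burge (N L a b : nat) (M j : int) : (L <= N)%N ->
  \sum_(i < N.+1) q ^ (i%:Z ^+ 2) * qbin q (2 * L%:Z + M - i%:Z) (2 * L%:Z)
     * qB q (L%:Z - i%:Z) i (a%:Z * j) (b%:Z * j)
  = q ^ ((b%:Z * j) ^+ 2) * qB q L M ((a + b)%N%:Z * j) (b%:Z * j).
Proof.
have abE (k : nat) : (a + b)%N%:Z * k%:Z = (a * k)%N%:Z + (b * k)%N%:Z.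
  by rewrite PoszD mulrDl.
move=> LN; case: (lerP 0 j) => j0.
  have [k ->] : exists k : nat, j = k by exists `|j|%N; lia.
  by rewrite abE -(PoszM a) -(PoszM b) (Burge_nat _ _ _ LN).
have [k ->] : exists k : nat, j = - k%:Z by exists `|j|%N; lia.
rewrite !mulrN qB_opp sqrrN abE -(PoszM b) -(Burge_nat _ _ _ LN).
by apply: eq_bigr => i _; rewrite qB_opp.
Qed.

Lemma lhs_exp2 (a b : nat) (j : int) :
  lhs_exp a b j * 2 = j * ((2 * a * b + 1)%N%:Z * j + 1).
Proof.
rewrite /lhs_exp divzK //; apply/dvdzP.
(* Parity: for odd [j] the other factor is even. *)
have [k [->|->]] : exists k : int, j = 2 * k \/ j = 2 * k + 1.
  by exists (j %/ 2)%Z; lia.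
- by exists (k * ((2 * a * b + 1)%N%:Z * (2 * k) + 1)); ring.
- exists ((2 * k + 1) * ((a * b)%N%:Z * (2 * k + 1) + k + 1)).
  by rewrite !(PoszD, PoszM); ring.
Qed.

(** The increment is exactly the power of [q] produced by [Burge], so the alternating sum is
    transformed termwise. *)
Lemma lhs_exp_Burge (a b : nat) (j : int) :
  lhs_exp (a + b) b j = lhs_exp a b j + (b%:Z * j) ^+ 2.
Proof.
have two_inj (x y : int) : x * 2 = y * 2 -> x = y by lia.
apply: two_inj; rewrite mulrDl !lhs_exp2 !(PoszD, PoszM); ring.
Qed.

Lemma lhs_expC (a b : nat) (j : int) : lhs_exp a b j = lhs_exp b a j.
Proof. by rewrite /lhs_exp mulnAC. Qed.

(** The left-hand side truncated at [K], with integer [L] and [M] since the recursion evaluates it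
    at [L - i] even when [i > L]. *)
Definition alt_sum (K a b : nat) (L M : int) : R :=
  zsum_trunc (fun j => (-1) ^ j * q ^ lhs_exp a b j * qB q L M (a%:Z * j) (b%:Z * j)) K.

Lemma alt_sum_neg (K a b : nat) (L M : int) : M < 0 -> alt_sum K a b L M = 0.
Proof. by move=> M0; apply: big1 => j _; rewrite qB_neg // mulr0. Qed.

Lemma alt_sumC (K a b : nat) (L M : int) : alt_sum K a b L M = alt_sum K b a M L.
Proof. by apply: eq_bigr => j _; rewrite qB_sym lhs_expC. Qed.

(** [Burge] leaves the index [j] alone, so the identity is exact at every truncation [K]. *)
Lemma alt_sum_Burge (K N L a b : nat) (M : int) : (L <= N)%N ->
  \sum_(i < N.+1) q ^ (i%:Z ^+ 2) * qbin q (2 * L%:Z + M - i%:Z) (2 * L%:Z)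
     * alt_sum K a b (L%:Z - i%:Z) i
  = alt_sum K (a + b) b L M.
Proof.
move=> LN; under eq_bigr => i _ do rewrite /alt_sum /zsum_trunc big_distrr /=.
rewrite exchange_big; apply: eq_bigr => j _ /=.
rewrite lhs_exp_Burge (expfzDr _ _ hq0) mulrA -[RHS]mulrA -(Burge _ _ _ _ LN) big_distrr /=.
by apply: eq_bigr => i _; ring.
Qed.

Lemma alt_sum_step (K N L a b : nat) (M : int) : (L <= N)%N ->
  \sum_(i < N.+1) q ^ (i%:Z ^+ 2) * qbin q (2 * L%:Z + M - i%:Z) (2 * L%:Z)
     * alt_sum K a b i (L%:Z - i%:Z)
  = alt_sum K (b + a) a L M.
Proof.
by move=> LN; rewrite -(alt_sum_Burge _ _ _ _ LN); apply: eq_bigr => i _; rewrite alt_sumC.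
Qed.

(** The Burge sum read backwards, [i] becoming [L - i]: this keeps the order of the pair, whereas
    [alt_sum_step] exchanges it by [alt_sumC]. *)
Lemma alt_sum_step_rev (K N L a b : nat) (M : int) : (L <= N)%N ->
  \sum_(i < N.+1) q ^ ((L%:Z - i%:Z) ^+ 2) * qbin q (L%:Z + M + i%:Z) (2 * L%:Z)
     * alt_sum K a b i (L%:Z - i%:Z)
  = alt_sum K (a + b) b L M.
Proof.
move=> LN; rewrite -(alt_sum_Burge _ _ _ _ (leqnn L)).
rewrite (@sum_ord_trunc _ L.+1 N.+1 (fun i : nat => q ^ ((L%:Z - i%:Z) ^+ 2) *
  qbin q (L%:Z + M + i%:Z) (2 * L%:Z) * alt_sum K a b i (L%:Z - i%:Z))) //; last first.
  by move=> k Lk; rewrite alt_sum_neg ?mulr0 //; lia.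
rewrite (reindex_inj rev_ord_inj) /=; apply: eq_bigr => i _.
have -> : Posz (L.+1 - i.+1) = L%:Z - i%:Z by have := ltn_ord i; lia.
by congr (_ ^ (_ ^+ 2) * qbin _ _ _ * alt_sum _ _ _ _ _); lia.
Qed.


(** * Symmetric truncated sums and the q-Dixon evaluation at (1,1) *)

Lemma zsum_truncS (f : int -> R) (N : nat) :
  zsum_trunc f N.+1 = zsum_trunc f N + (f N.+1%:Z + f (- N.+1%:Z)).
Proof.
rewrite /zsum_trunc -!(big_mkord xpredT (fun i : nat => f (i%:Z - _%:Z))).
rewrite (_ : (2 * N.+1).+1 = (2 * N).+3); last by lia.
rewrite big_nat_recl // big_nat_recr //= addrCA [f _ + _]addrC.
congr (_ + (_ + _)); last by congr f; lia.
  by apply: eq_bigr => i _; congr f; lia.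
by congr f; lia.
Qed.

Lemma zsum_trunc0 (f : int -> R) : zsum_trunc f 0 = f 0.
Proof. by rewrite /zsum_trunc big_ord1 subrr. Qed.

Lemma zsum_trunc_opp (f : int -> R) (N : nat) :
  zsum_trunc (fun j => f (- j)) N = zsum_trunc f N.
Proof.
elim: N => [|N IH]; first by rewrite !zsum_trunc0 oppr0.
by rewrite !zsum_truncS IH opprK [f (- _) + _]addrC.
Qed.

(** The reflection [j -> -1 - j] cancels [-N, ..., -1] against [0, ..., N - 1] and leaves the index
    [N] unpaired. *)
Lemma zsum_trunc_antisym (f : int -> R) (N : nat) :
  (forall j, f (-1 - j) = - f j) -> zsum_trunc f N = f N.
Proof.
move=> fN; elim: N => [|N IH]; first by rewrite zsum_trunc0.
by rewrite zsum_truncS IH (_ : - N.+1%:Z = -1 - N%:Z) ?fN; [ring | lia].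
Qed.

Lemma zsum_trunc_only0 (f : int -> R) (N : nat) :
  (forall j, j != 0 -> f j = 0) -> zsum_trunc f N = f 0.
Proof.
move=> f0; elim: N => [|N IH]; first by rewrite zsum_trunc0.
by rewrite zsum_truncS IH (f0 N.+1%:Z) ?(f0 (- N.+1%:Z)) ?addr0.
Qed.

(** Eliminating [qbin q n k] between the two Pascal rules gives this without any case split on
    [k]. *)
Lemma qbin_absorb (n : nat) (k : int) :
  (1 - q ^ k) * qbin q n.+1 k = (1 - q ^+ n.+1) * qbin q n (k - 1).
Proof.
rewrite mulrBl mul1r {1}qbinS qbinS' mulrDr mulrA -expfzDr //.
by rewrite (_ : k + (n.+1%:Z - k) = n.+1) -?exprnP; [ring | lia].
Qed.

Lemma signz_opp (j : int) : (-1) ^ (- j) = (-1) ^ j :> R.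
Proof. by rewrite -invr_expz expfV invrN1. Qed.

(* The first q-Pascal rule on both factors, and (after [j -> -j]) one rule on
   each factor, expand the same sum with a common unknown cross term [U];
   eliminating it leaves the recurrence of the q-binomial. *)
Lemma qDixon (K N : nat) (L : int) : L <= K%:Z ->
  let S n l := zsum_trunc (fun j => (-1) ^ j * q ^ lhs_exp 1 1 j *
                 (qbin q n (l + j) * qbin q n (l - j))) K in
  (1 - q ^ L) * S N.+1%:Z L = (1 - q ^+ N.+1) * S N%:Z (L - 1).
Proof.
move=> LK S.
set U := zsum_trunc (fun j => (-1) ^ j * q ^ (lhs_exp 1 1 j - j) *
           (qbin q N (L + j - 1) * qbin q N (L - j))) K.
have wE (j : int) : lhs_exp 1 1 j * 2 = j * (3 * j + 1) by rewrite lhs_exp2.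
have qD := expfzDr _ _ hq0; have qN (j : int) : q ^ (- j) = (q ^ j)^-1 by rewrite invr_expz.
(* The other cross term is antisymmetric, as its exponent [3j(j + 1)/2] is invariant under
   [j -> -1 - j]; the unpaired term at [j = K] has lower index [L - K - 1 < 0]. *)
have Z : zsum_trunc (fun j => (-1) ^ j * q ^ (lhs_exp 1 1 j + j) *
           (qbin q N (L + j) * qbin q N (L - j - 1))) K = 0.
  rewrite zsum_trunc_antisym; first by rewrite (@qbin_neg _ (L - K%:Z - 1)) ?mulr0 //; lia.
  move=> j; have -> : L + (-1 - j) = L - j - 1 by lia.
  have -> : L - (-1 - j) - 1 = L + j by lia.
  rewrite [qbin _ _ _ * _]mulrC -!mulNr; congr (_ * _ ^ _ * _).
    by rewrite expfzDr ?oppr_eq0 ?oner_eq0 // !signz_opp expr1z mulN1r.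
  have := wE j; have := wE (-1 - j); nia.
have rel1 : S N.+1%:Z L = S N%:Z (L - 1) + q ^ L * (q ^ L * S N%:Z L + U).
  rewrite -[RHS]addr0 -[X in _ + X](mulr0 (q ^ L)) -Z /U /S /zsum_trunc.
  rewrite mulrDr !big_distrr -!big_split; apply: eq_bigr => i _ /=.
  move: (Posz i - K%:Z) => j; rewrite (qbinS N (L + j)) (qbinS N (L - j)) !(qD, qN).
  have J0 : q ^ j != 0 by rewrite expfz_neq0.
  rewrite (_ : L - 1 + j = L + j - 1) 1?(_ : L - 1 - j = L - j - 1); try lia.
  by field.
have rel2 : S N.+1%:Z L = U + q ^ L * S N%:Z L + q ^ (N.+1%:Z - L) * S N%:Z (L - 1).
  rewrite -[RHS]addr0 -[X in _ + X](mulr0 (q ^ N.+1%:Z)) -Z.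
  rewrite /S -zsum_trunc_opp /U /zsum_trunc.
  rewrite !big_distrr -!big_split; apply: eq_bigr => i _ /=.
  move: (Posz i - K%:Z) => j; rewrite opprK (qbinS N (L + j)) (qbinS' N (L - j)).
  rewrite (_ : lhs_exp 1 1 (- j) = lhs_exp 1 1 j - j); last first.
    by have := wE j; have := wE (- j); nia.
  have -> : N.+1%:Z - (L - j) = N.+1%:Z - L + j by lia.
  rewrite !(qD, qN).
  rewrite (_ : L - 1 + j = L + j - 1) 1?(_ : L - 1 - j = L - j - 1); try lia.
  have J0 : q ^ j != 0 by rewrite expfz_neq0.
  have L0 : q ^ L != 0 by rewrite expfz_neq0.
  by rewrite signz_opp; field; rewrite J0 L0.
rewrite mulrBl mul1r {1}rel1 rel2 !mulrDr [q ^ L * (q ^ _ * S _ (L - 1))]mulrA -qD.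
by rewrite (_ : L + (N.+1%:Z - L) = N.+1) -?exprnP; [ring | lia].
Qed.

(** Induction on [N = L + M]: by [qDixon] and [qbin_absorb] both sides obey one recurrence, whose
    factor [1 - q^(L+1)] is invertible. *)
Lemma alt_sum11 (K L M : nat) : (L <= K)%N -> alt_sum K 1 1 L M = qbin q (L%:Z + M%:Z) L.
Proof.
move=> LK; transitivity (zsum_trunc (fun j => (-1) ^ j * q ^ lhs_exp 1 1 j *
                 (qbin q (L + M)%N (L%:Z + j) * qbin q (L + M)%N (L%:Z - j))) K).
  by apply: eq_bigr => i _; rewrite /qB !mul1r; congr (_ * (qbin _ _ _ * qbin _ _ _)); lia.
rewrite -PoszD; move: (L + M)%N => N.
elim: N L LK => [|N IH] [|L] LK.
(* For [L = 0] only [j = 0] survives, since [j] or [-j] is a negative lower index otherwise. *)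
1,3: rewrite zsum_trunc_only0 ?addr0 ?subr0 ?mulr1 ?qbin0 //=; first by rewrite expr0z !mul1r.
1,2: move=> j; rewrite neq_lt !add0r => /orP[] j0; first by rewrite qbin_neg ?mul0r ?mulr0.
1,2: by rewrite (@qbin_neg _ (- j)) ?mulr0 //; lia.
- rewrite qbin_small //; apply: big1 => i _; move: (Posz i - K%:Z) => j; case: (lerP 0 j) => j0.
    by rewrite qbin_small ?mul0r ?mulr0 //; lia.
  by rewrite (@qbin_small _ (_ - j)) ?mulr0 //; lia.
- apply: (mulfI (qfactor_neq0 L)).
  have := @qDixon K N L.+1; rewrite /= => -> //.
  rewrite -[q ^+ L.+1]/(q ^ L.+1%:Z) qbin_absorb (_ : L.+1%:Z - 1 = L) ?IH //; lia.
Qed.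
End QBinomial.

(** * The box sum along the continued fraction *)

Lemma cf_weight_one (R : fieldType) (q : R) (L x : nat) (m : nat -> nat) :
  cf_weight q [:: 1%N] L (mcons x m) = qbin q L x.
Proof.
rewrite /cf_weight /mCm /prod_factor /cf_n /= !big_nat1 /= mul1n.
rewrite (_ : cf_C _ 1 1 = 1); last by rewrite /cf_C /cf_I /cf_t inE.
rewrite mulr1 (_ : x%:Z * x%:Z - x%:Z ^+ 2 = 0); last by ring.
by rewrite expr0z mul1r; congr qbin; rewrite /dlt /=; lia.
Qed.

Lemma coprime_subl (a b : nat) : (b <= a)%N -> coprime (a - b) b = coprime a b.
Proof. by move=> ba; rewrite !(coprime_sym _ b) /coprime -(gcdnDl b (a - b)) subnKC. Qed.

Section ContinuedFraction.
Variables (R : fieldType) (q : R).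
Hypothesis hq0 : q != 0.
Hypothesis hq : forall n : nat, (0 < n)%N -> q ^+ n != 1.

(** The pair [(C_11, C_12)] is [(2, -1)] or [(1, 1)]; the prefactor is then the kernel of
    [alt_sum_step_rev] or of [alt_sum_step], at [M = L - x]. *)
Lemma cf_weight_minor (s s' : seq nat) (L x : nat) (m : nat -> nat) :
  cf_minor s s' ->
  cf_weight q s L (mcons x m) =
  q ^ ((m 1%N)%:Z ^+ 2 + (cf_C s 1 1 - 1) * x%:Z ^+ 2 + (cf_C s 1 2 - 1) * x%:Z * (m 1%N)%:Z)
  * qbin q (2 * x%:Z + L%:Z - cf_C s 1 1 * x%:Z - cf_C s 1 2 * (m 1%N)%:Z) (2 * x%:Z)
  * cf_weight q s' x m.
Proof.
move=> ss'; rewrite /cf_weight (mCm_minor ss') (prod_factor_minor ss') (cf_n_first ss') /=.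
rewrite mulrACA -(expfzDr _ _ hq0) PoszM; congr (_ ^ _ * (qbin _ _ _ * _)); ring.
Qed.

Lemma cf_weight_minor_inner (x : nat) (s : seq nat) (L y : nat) (m : nat -> nat) :
  cf_weight q (x.+2 :: s) L (mcons y m) =
  q ^ ((y%:Z - (m 1%N)%:Z) ^+ 2) * qbin q (y%:Z + (L%:Z - y%:Z) + (m 1%N)%:Z) (2 * y%:Z)
  * cf_weight q (x.+1 :: s) y m.
Proof.
rewrite (cf_weight_minor _ _ _ (cf_minor_succ x s)) /cf_C /cf_I.
rewrite (negbTE (one_notin_cf_t x s)) /dlt /=.
by congr (_ ^ _ * qbin _ _ _ * _); ring.
Qed.

Lemma cf_weight_minor_corner (s : seq nat) (L y : nat) (m : nat -> nat) :
  (0 < cf_d s)%N ->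
  cf_weight q (1%N :: s) L (mcons y m) =
  q ^ ((m 1%N)%:Z ^+ 2) * qbin q (2 * y%:Z + (L%:Z - y%:Z) - (m 1%N)%:Z) (2 * y%:Z)
  * cf_weight q s y m.
Proof.
move=> s0; rewrite (cf_weight_minor _ _ _ (cf_minor_one s0)) /cf_C /cf_I one_in_cf_t /dlt /=.
by congr (_ ^ _ * qbin _ _ _ * _); ring.
Qed.

(* The weight [phi] of [m_1] is what the outer Burge step contributes. *)
Lemma box_trunc_cf (s : seq nat) (a b L N K : nat) (phi : nat -> R) :
  all (fun x => 0 < x)%N s -> s <> [::] -> (0 < a)%N -> (0 < b)%N -> coprime a b ->
  cf_value s = a%:R / b%:R -> (L <= N)%N -> (N <= K)%N ->
  box_trunc (cf_d s) (fun m => phi (m 1%N) * cf_weight q s L m) N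
  = \sum_(x < N.+1) phi x * alt_sum q K a b x (L%:Z - x%:Z).
Proof.
move=> + + + + + + + NK; have [d] := ubnP (cf_d s).
(* At each step the first coordinate becomes the new [L] and a Burge kernel the new [phi]; the
   bounds [N] and [K] stay fixed. *)
elim: d s a b L phi => // d IH s a b L phi sd s_pos s_nil a0 b0 ab sE LN.
have ext (t : seq nat) (l : nat) (f : nat -> R) m m' :
    m =1 m' -> f (m 1%N) * cf_weight q t l m = f (m' 1%N) * cf_weight q t l m'.
  by move=> mm'; rewrite mm' (eq_cf_weight _ _ _ mm').
have b_neq0 : b%:R != 0 :> rat by rewrite pnatr_eq0; lia.
have a_neq0 : a%:R != 0 :> rat by rewrite pnatr_eq0; lia.
case: s s_nil s_pos sd sE => // -[//|[|x]] s _ /= s_pos sd sE.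
- case: s => [|y s] in s_pos sd sE *.
    (* The fraction [[1]] has value 1, so coprimality forces [a = b = 1]. *)
    have eq_ab : a = b.
      apply/eqP; rewrite -(eqr_nat rat); apply/eqP.
      by rewrite -[LHS](divfK b_neq0) -sE mul1r.
    have a1 : a = 1%N by move: ab; rewrite -eq_ab /coprime gcdnn => /eqP.
    rewrite box_trunc1; last exact: ext.
    apply: eq_bigr => x _; rewrite -eq_ab a1 cf_weight_one /=; congr (_ * _).
    have xN := ltn_ord x; case: (leqP x L) => xL.
      rewrite (_ : L%:Z - x%:Z = (L - x)%N) ?alt_sum11 //; [|lia|lia].
      by congr qbin; lia.
    by rewrite qbin_small ?alt_sum_neg //; lia.
  (* Leading digit 1 with a nonempty tail: inverting [a/b - 1] makes the tail represent
     [(b, a - b)], an exchange step. *)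
  have ys0 : 0 < cf_value (y :: s) by apply: cf_value_gt0.
  have ba : (b < a)%N.
    by rewrite -(ltr_nat rat) -[b%:R]mul1r -ltr_pdivlMr ?ltr0n // -sE ltrDl invr_gt0.
  have ysE : cf_value (y :: s) = b%:R / (a - b)%N%:R.
    rewrite natrB ?(ltnW ba) // -[LHS]invrK -[RHS]invrK; congr (_^-1).
    by rewrite invf_div mulrBl divff // -sE addrC addKr.
  have d0 : (0 < cf_d (y :: s))%N by case/andP: s_pos; rewrite /cf_d /= => ? _; lia.
  rewrite -[(1 + _)%N]/(cf_d (y :: s)).+1 box_trunc_cons; last exact: ext.
  apply: eq_bigr => z _.
  transitivity (phi z * box_trunc (cf_d (y :: s)) (fun m => (q ^ ((m 1%N)%:Z ^+ 2) *
      qbin q (2 * z%:Z + (L%:Z - z%:Z) - (m 1%N)%:Z) (2 * z%:Z)) * cf_weight q (y :: s) z m) N).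
    by rewrite /box_trunc big_distrr; apply: eq_bigr => f _; rewrite /= cf_weight_minor_corner.
  have zN : (z <= N)%N by rewrite -ltnS.
  rewrite (IH _ b (a - b)%N z (fun i : nat => q ^ (i%:Z ^+ 2) * 
    qbin q (2 * z%:Z + (L%:Z - z%:Z) - i%:Z) (2 * z%:Z))) //; last 2 first.
  - by rewrite subn_gt0.
  - by rewrite coprime_sym coprime_subl // ltnW.
  by rewrite alt_sum_step // subnK // ltnW.
(* Leading digit at least 2: lowering it by one passes to [(a - b, b)] in the same order. *)
have xs_gt0 : 0 < cf_value (x.+1 :: s) by apply: cf_value_gt0.
have xsE : cf_value (x.+1 :: s) = a%:R / b%:R - 1.
  by rewrite -sE -/(cf_value (x.+2 :: s)) (cf_value_succ x.+1) addrC addKr.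
have ba : (b < a)%N.
  by rewrite -(ltr_nat rat) -[b%:R]mul1r -ltr_pdivlMr ?ltr0n // -subr_gt0 -xsE.
rewrite -[(x.+2 + _)%N]/(cf_d (x.+1 :: s)).+1 box_trunc_cons; last exact: ext.
apply: eq_bigr => z _.
transitivity (phi z * box_trunc (cf_d (x.+1 :: s)) (fun m => (q ^ ((z%:Z - (m 1%N)%:Z) ^+ 2) *
    qbin q (z%:Z + (L%:Z - z%:Z) + (m 1%N)%:Z) (2 * z%:Z)) * cf_weight q (x.+1 :: s) z m) N).
  by rewrite /box_trunc big_distrr; apply: eq_bigr => f _; rewrite /= cf_weight_minor_inner.
have zN : (z <= N)%N by rewrite -ltnS.
rewrite (IH _ (a - b)%N b z (fun i : nat => q ^ ((z%:Z - i%:Z) ^+ 2) *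
  qbin q (z%:Z + (L%:Z - z%:Z) + i%:Z) (2 * z%:Z))) //.
- by rewrite alt_sum_step_rev // subnK // ltnW.
- by rewrite subn_gt0.
- by rewrite coprime_subl // ltnW.
- by rewrite xsE natrB ?(ltnW ba) // mulrBl divff.
Qed.

(** The summand of F is one more Burge kernel times [cf_weight], and [cfval] is the quotient of the
    pair one step below [(a, b)]. *)
Lemma box_trunc_F_term (s : seq nat) (a b L M N K : nat) :
  (0 < b)%N -> (b < a)%N -> coprime a b -> is_cf_rep a b s -> (L <= N)%N -> (N <= K)%N ->
  box_trunc (cf_d s) (F_term q a b s L M) N = alt_sum q K a b L M.
Proof.
move=> b0 ba ab [s_nil s_pos sE _] LN NK.
have a0 : (0 < a - b)%N by rewrite subn_gt0.
have ab' : coprime (a - b) b by rewrite coprime_subl // ltnW.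
have b_neq0 : b%:R != 0 :> rat by rewrite pnatr_eq0; lia.
have valE : a%:R / b%:R - 1 = (a - b)%N%:R / b%:R :> rat.
  by rewrite natrB ?(ltnW ba) // mulrBl divff.
have [ab2|ab2] := leqP a (2 * b).
  (* The boundary case [a = 2b] belongs here: there [a - b = b] and the value is 1. *)
  have {}sE : cf_value s = b%:R / (a - b)%N%:R.
    rewrite sE /cfval ltnNge ab2 /= valE invf_div; case: ltnP => // ab2'.
    by rewrite (_ : (a - b)%N = b) ?divff //; lia.
  transitivity (box_trunc (cf_d s) (fun m => (q ^ ((m 1%N)%:Z ^+ 2) *
      qbin q (2 * L%:Z + M%:Z - (m 1%N)%:Z) (2 * L%:Z)) * cf_weight q s L m) N).
    apply: eq_bigr => f _; rewrite /F_term ab2 /cf_weight mulrACA -(expfzDr _ _ hq0) mulrA.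
    by congr (_ ^ _ * _ * _); ring.
  rewrite (@box_trunc_cf _ b (a - b) _ _ K (fun i => q ^ (i%:Z ^+ 2) *
      qbin q (2 * L%:Z + M%:Z - i%:Z) (2 * L%:Z))) //; last by rewrite coprime_sym.
  by rewrite alt_sum_step // subnK // ltnW.
have {}sE : cf_value s = (a - b)%N%:R / b%:R by rewrite sE /cfval ab2 valE.
transitivity (box_trunc (cf_d s) (fun m => (q ^ ((L%:Z - (m 1%N)%:Z) ^+ 2) *
    qbin q (L%:Z + M%:Z + (m 1%N)%:Z) (2 * L%:Z)) * cf_weight q s L m) N).
  apply: eq_bigr => f _; rewrite /F_term leqNgt ab2 /cf_weight mulrACA -(expfzDr _ _ hq0) mulrA.
  by congr (_ ^ _ * _ * _); ring.
rewrite (@box_trunc_cf _ (a - b) b _ _ K (fun i => q ^ ((L%:Z - i%:Z) ^+ 2) *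
    qbin q (L%:Z + M%:Z + i%:Z) (2 * L%:Z))) //.
by rewrite alt_sum_step_rev // subnK // ltnW.
Qed.
End ContinuedFraction.

Theorem theorem3p3 (R : fieldType) (q : R)
    (hq0 : q != 0) (hq : forall n : nat, (0 < n)%N -> q ^+ n != 1)
    (L M a b : nat) (cfl : seq nat)
    (hb : (1 <= b)%N) (hba : (b < a)%N) (hcop : coprime a b)
    (hcf : is_cf_rep a b cfl) :
  exists s : R,
    zsum_is (lhs_term q a b L M) s /\
    boxsum_is (cf_d cfl) (F_term q a b cfl L M) s.
Proof.
have eqF := box_trunc_F_term (L := L) hq0 hq M hb hba hcop hcf.
(* Box bound and index bound are independent within [L <= N <= K], so both truncations are constant
   from [L] on. *)
exists (box_trunc (cf_d cfl) (F_term q a b cfl L M) L); split; exists L => N LN.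
  by rewrite (eqF L N).
by rewrite (eqF N N) // (eqF L N).
Qed.
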